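(* Let $(n_k)_{k\in\mathbb{N}}$ and $(m_k)_{k\in\mathbb{N}}$ be two sequences of positive integers with $m_k\geq n_k/2$ for every $k\in\mathbb{N}$, and let $t:=\sup_{k\in\mathbb{N}}\{n_k/m_k\}$. Let $Q\in\mathbb{R}[x]$ be a polynomial and let $\{f_k:\mathbb{Z}_{n_k}\to\mathbb{C}\}_{k\in\mathbb{N}}$ be a family of functions with $\|f_k\|_2^2\le Q(\log(n_k))$ for all $k\in\mathbb{N}$. Let $\epsilon>0$. If $\{f_k\}_{k\in\mathbb{N}}$ is $\epsilon$-concentrated, then for every $\eta>0$ the family $\{\widetilde{f_k}:\mathbb{Z}_{m_k}\to\mathbb{C}\}_{k\in\mathbb{N}}$ is $(t\epsilon+\eta)$-concentrated.
   Context: $\mathbb{Z}_n=\{0,1,\dots,n-1\}$ with addition mod $n$. For $f,g:\mathbb{Z}_n\to\mathbb{C}$, $\langle f,g\rangle=\frac1n\sum_{x\in\mathbb{Z}_n}f(x)\overline{g(x)}$ and $\|f\|_2^2=\langle f,f\rangle$. For $\alpha\in\mathbb{Z}_n$, $\chi_\alpha(x)=\exp(2\pi i\alpha x/n)$ and $\widehat f(\alpha)=\langle f,\chi_\alpha\rangle$. For $\Gamma\subseteq\mathbb{Z}_n$, $f|_\Gamma(x)=\sum_{\alpha\in\Gamma}\widehat f(\alpha)\chi_\alpha(x)$ (a function on $\mathbb{Z}_n$). For $f:\mathbb{Z}_n\to\mathbb{C}$ and $m\in\mathbb{N}$, $\widetilde f:\mathbb{Z}_m\to\mathbb{C}$ is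 $\widetilde f(x)=f(x)$ for $0\le x<\min(n,m)$ and $0$ otherwise. For $\delta>0$, a family $\{f_k:\mathbb{Z}_{n_k}\to\mathbb{C}\}_{k\in\mathbb{N}}$ is $\delta$-concentrated if there is a polynomial $P\in\mathbb{R}[x]$ such that for all $k\in\mathbb{N}$ there is $\Gamma_k\subseteq\mathbb{Z}_{n_k}$ with $|\Gamma_k|\le P(\log(n_k))$ and $\|f_k-f_k|_{\Gamma_k}\|_2^2<\delta$. *)

(* Defs.v *)
From HB Require Import structures.
From mathcomp Require Import all_boot all_order all_algebra.
From mathcomp Require Import all_classical all_reals all_analysis.
From mathcomp Require Import complex.
Set Implicit Arguments. Unset Strict Implicit. Unset Printing Implicit Defensive.
Import Order.TTheory GRing.Theory Num.Theory.
Local Open Scope ring_scope.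

Section Fourier.
Variable R : realType.
Local Notation C := (R[i]).

(* A function Z_n -> C is a function on 'I_n (addition mod n is irrelevant
   to the definitions below). *)

Definition chi (n : nat) (alpha x : 'I_n) : C :=
  let th := 2 * pi * (alpha * x)%:R / n%:R in Complex (cos th) (sin th).

Definition inner (n : nat) (f g : 'I_n -> C) : C :=
  (n%:R)^-1 * \sum_(x < n) f x * conjc (g x).

Definition norm2sq (n : nat) (f : 'I_n -> C) : R := complex.Re (inner f f).

Definition fhat (n : nat) (f : 'I_n -> C) (alpha : 'I_n) : C :=
  inner f (chi alpha).

Definition restr (n : nat) (f : 'I_n -> C) (Gamma : {set 'I_n}) (x : 'I_n) : C :=
  \sum_(alpha in Gamma) fhat f alpha * chi alpha x.

Definition ftilde (n m : nat) (f : 'I_n -> C) (x : 'I_m) : C :=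
  match @insub nat (fun y => y < n)%N 'I_n (val x) with
  | Some y => f y
  | None => 0
  end.

Definition concentrated (delta : R) (n : nat -> nat)
    (f : forall k, 'I_(n k) -> C) : Prop :=
  exists P : {poly R}, forall k : nat,
    exists Gamma : {set 'I_(n k)},
      (#|Gamma|%:R <= P.[ln (n k)%:R]) /\
      norm2sq (fun x => f k x - restr (f k) Gamma x) < delta.

End Fourier.

(* Main.v *)
Require Import Defs.
From HB Require Import structures.
From mathcomp Require Import all_boot all_order all_algebra.
From mathcomp Require Import all_classical all_reals all_analysis.
From mathcomp Require Import complex ring lra.
Set Implicit Arguments. Unset Strict Implicit. Unset Printing Implicit Defensive.
Import Order.TTheory GRing.Theory Num.Theory numFieldNormedType.Exports.
Local Open Scope ring_scope.

(** Write f = h + g with g = f|_Gamma. Restricting h to Z_m multiplies its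
    squared norm by at most n / m. Each truncated character chi_alpha of Z_n has
    on Z_m a Fourier coefficient at beta which is a geometric sum, of size
    O(1 / d) where d is the cyclic distance in R/mZ from beta to alpha m / n; so
    only O(L) frequencies have d < L, and the others carry energy O(1 / L).
    Keeping the frequencies at distance < L from some alpha in Gamma therefore
    leaves an error O(|Gamma|^2 ||f||^2 / L) for the truncation of g, which is
    small when L is a suitable polynomial in log m. The two errors are combined
    with |z + w|^2 <= (1 + c) |z|^2 + (1 + 1/c) |w|^2 for a small fixed c. *)

(** * Squared modulus of complex numbers *)

Section SquaredModulus.
Variable R : realType.
Implicit Types z w : R[i].

Definition sqn z : R := complex.Re z ^+ 2 + complex.Im z ^+ 2.

Lemma sqnE z : (sqn z)%:C%C = z * z^*%C.
Proof. by rewrite add_Re2_Im2 sqr_normc. Qed.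

Lemma sqn_ge0 z : 0 <= sqn z.
Proof. by rewrite addr_ge0 ?sqr_ge0. Qed.

Lemma sqn0 : sqn 0 = 0.
Proof. by rewrite /sqn /=; ring. Qed.

Lemma sqnM z w : sqn (z * w) = sqn z * sqn w.
Proof. by case: z => a b; case: w => c d; rewrite /sqn /=; ring. Qed.

(** The right side minus the left is [c^-1] times the squared modulus of [c * z - w]. *)
Lemma sqnD_le (c : R) z w : 0 < c ->
  sqn (z + w) <= (1 + c) * sqn z + (1 + c^-1) * sqn w.
Proof.
move=> c0; case: z => a b; case: w => x y; rewrite /sqn /= -subr_ge0.
have -> : (1 + c) * (a ^+ 2 + b ^+ 2) + (1 + c^-1) * (x ^+ 2 + y ^+ 2) -
   ((a + x) ^+ 2 + (b + y) ^+ 2) = c^-1 * ((c * a - x) ^+ 2 + (c * b - y) ^+ 2).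
  by field; rewrite gt_eqF.
by rewrite mulr_ge0 ?invr_ge0 ?(ltW c0)// addr_ge0 ?sqr_ge0.
Qed.

(** Cauchy-Schwarz against the constant 1, obtained for real and imaginary parts separately by
    expanding the nonnegative double sum of [(G i - G j) ^+ 2]. *)
Lemma sqn_sum (I : finType) (A : {pred I}) (F : I -> R[i]) :
  sqn (\sum_(i in A) F i) <= #|A|%:R * \sum_(i in A) sqn (F i).
Proof.
have sqr_sum (G : I -> R) :
    (\sum_(i in A) G i) ^+ 2 <= #|A|%:R * \sum_(i in A) G i ^+ 2.
  have : 0 <= \sum_(i in A) \sum_(j in A) (G i - G j) ^+ 2.
    by apply: sumr_ge0 => i _; apply: sumr_ge0 => j _; rewrite sqr_ge0.
  have -> : \sum_(i in A) \sum_(j in A) (G i - G j) ^+ 2 =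
      (#|A|%:R * \sum_(i in A) G i ^+ 2 - (\sum_(i in A) G i) ^+ 2) *+ 2.
    transitivity (\sum_(i in A) (#|A|%:R * G i ^+ 2 + \sum_(j in A) G j ^+ 2
        - G i * (\sum_(j in A) G j) *+ 2)).
      apply: eq_bigr => i _.
      under eq_bigr do rewrite sqrrB.
      rewrite !big_split/= sumr_const sumrN sumrMnl -mulr_sumr -mulr_natl.
      by ring.
    rewrite !big_split/= sumrN sumrMnl -mulr_suml -mulr_sumr sumr_const -mulr_natl.
    by ring.
  by rewrite pmulrn_lge0// subr_ge0.
have [re im] : complex.Re (\sum_(i in A) F i) = \sum_(i in A) complex.Re (F i)
           /\ complex.Im (\sum_(i in A) F i) = \sum_(i in A) complex.Im (F i).
  by split; apply: (big_morph _ (id1 := 0)) => // -[a b] [c d].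
by rewrite /sqn re im big_split/= mulrDr lerD.
Qed.

End SquaredModulus.

(** * Unit complex numbers and lower bounds for the sine *)

Section Expi.
Variable R : realType.
Implicit Types s t : R.

Definition expi t : R[i] := Complex (cos t) (sin t).

Lemma expi0 : expi 0 = 1.
Proof. by rewrite /expi cos0 sin0. Qed.

Lemma expiD s t : expi (s + t) = expi s * expi t.
Proof. 
by apply/eqP; rewrite eq_complex /= cosD sinD; apply/andP; split; apply/eqP; ring.
Qed.

Lemma conj_expi t : (expi t)^*%C = expi (- t).
Proof. by rewrite /expi cosN sinN. Qed.

Lemma expiX t k : expi t ^+ k = expi (t *+ k).
Proof.
by elim: k => [|k ih]; rewrite ?expr0 ?mulr0n ?expi0// exprS mulrS expiD ih.
Qed.

Lemma expi_2pi k : expi (pi *+ 2 *+ k) = 1.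
Proof. by rewrite -expiX /expi cos2pi sin2pi expr1n. Qed.

Lemma sqn_expi_sub1 t : sqn (expi t - 1) = 4 * sin (t / 2) ^+ 2.
Proof.
rewrite [in LHS](_ : t = (t / 2) *+ 2); last first.
  by rewrite -mulr_natr divfK// pnatr_eq0.
move: (t / 2) => u.
rewrite /sqn /= cos_mulr2n sin_mulr2n.
have := cos2Dsin2 u; set c := cos u; set d := sin u => h.
have -> : c ^+ 2 = 1 - d ^+ 2 by rewrite -h addrK.
have -> : (c * d *+ 2 - 0) ^+ 2 = 4 * c ^+ 2 * d ^+ 2 by ring.
have -> : c ^+ 2 = 1 - d ^+ 2 by rewrite -h addrK.
by ring.
Qed.

Lemma sqn_expi_sub1_le t : sqn (expi t - 1) <= 4.
Proof.
by rewrite sqn_expi_sub1 -[leRHS]mulr1 ler_wpM2l.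
Qed.

(** If pi exceeded 4, then 2 would lie below pi / 2, where the cosine is positive, against cos 2 <
    0. *)
Lemma pi_le4 : pi <= 4 :> R.
Proof.
rewrite leNgt; apply/negP => pi4.
have : 0 < cos 2 :> R by apply: cos_gt0_pihalf; apply/andP; split; lra.
by rewrite ltNge (ltW (cos2_lt0 R)).
Qed.

(** If cos t >= 1/4, the cosine is at least 1/4 on all of [0, t] and the mean value theorem
    concludes; otherwise the sine is too close to 1 to fall below t / 4. *)
Lemma sin_ge_quarter t : 0 <= t <= pi / 2 -> t / 4 <= sin t.
Proof.
move=> /andP[t0 t1]; have := pi_le4 => pi4; have := pi_ge2 R => pi2.
have st : 0 <= sin t by apply: sin_ge0_pi; apply/andP; split; lra.
have [ct|ct] := leP (1 / 4) (cos t).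
  have cs : {within `[0, t], continuous (@sin R)}%classic.
    by apply: continuous_subspaceT => x; exact: continuous_sin.
  have [c /itvP ci] := MVT_segment t0 (fun x _ => is_derive_sin x) cs.
  rewrite sin0 !subr0 => ->; rewrite mulrC ler_wpM2r//.
  have : cos t <= cos c.
    have [c0 c1] : 0 <= c /\ c <= t by rewrite !ci.
    rewrite leNgt ltr_cos ?in_itv/=; first by rewrite -leNgt.
      by apply/andP; split; lra.
    by apply/andP; split; lra.
  lra.
have ct0 : 0 <= cos t by apply: cos_ge0_pihalf; apply/andP; split; lra.
rewrite leNgt; apply/negP => h.
have := cos2Dsin2 t.
(* Here 0 <= cos t < 1/4 and 0 <= sin t < t / 4 <= 1/2, the last bound because pi <= 4. *)
suff : cos t ^+ 2 + sin t ^+ 2 < 1 by move=> /[swap] ->; rewrite ltxx.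
by nra.
Qed.

(** The symmetry sin (pi - x) = sin x reduces to d <= m / 2, where [sin_ge_quarter] applies and pi
    >= 2 gives the constant. *)
Lemma sin_ge_min (m d : R) : 0 < m -> 0 <= d -> d <= m ->
  Num.min d (m - d) / (2 * m) <= sin (pi * d / m).
Proof.
have p2 := pi_ge2 R.
have half e : 0 < m -> 0 <= e -> e <= m / 2 -> e / (2 * m) <= sin (pi * e / m).
  move=> m0 e0 em; have em0 : 0 <= e / m by rewrite divr_ge0// ltW.
  have em1 : e / m <= 1 / 2 by rewrite ler_pdivrMr//; lra.
  have -> : e / (2 * m) = e / m / 2 by field; rewrite gt_eqF.
  rewrite -[pi * e / m]mulrA; move: (e / m) em0 em1 => x x0 x1.
  have x2 : 2 * x <= pi * x by rewrite ler_wpM2r.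
  have x3 : pi * x <= pi * (1 / 2) by rewrite ler_wpM2l// pi_ge0.
  apply: (@le_trans _ _ (pi * x / 4)); first by lra.
  by apply: sin_ge_quarter; apply/andP; split; lra.
move=> m0 d0 dm; have [dh|dh] := leP d (m - d); first by apply: half => //; lra.
have -> : pi * d / m = pi - pi * (m - d) / m by field; rewrite gt_eqF.
by rewrite sinB sinpi cospi mul0r sub0r mulN1r opprK; apply: half => //; lra.
Qed.

End Expi.

(** * Orthogonality, inversion and Parseval on Z_n *)

Section Fourier.
Variables (R : realType) (n : nat).
Local Arguments conjc : simpl never.
Implicit Types (f g : 'I_n -> R[i]) (A : {set 'I_n}) (alpha beta x : 'I_n).

Lemma norm2sqE f : norm2sq f = n%:R^-1 * \sum_x sqn (f x).
Proof.
rewrite /norm2sq /inner; under eq_bigr do rewrite -sqnE.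
by rewrite -rmorph_sum -(rmorph_nat (real_complex R)) -fmorphV -rmorphM.
Qed.

Lemma norm2sq_ge0 f : 0 <= norm2sq f.
Proof.
by rewrite norm2sqE mulr_ge0 ?invr_ge0// sumr_ge0// => x _; apply: sqn_ge0.
Qed.

Lemma chiE alpha x : chi R alpha x = expi (pi *+ 2 * alpha%:R / n%:R) ^+ x.
Proof.
rewrite expiX /chi /expi /= natrM.
by have -> : 2 * pi * (alpha%:R * x%:R) / n%:R = pi *+ 2 * alpha%:R / n%:R *+ x :> R
  by ring.
Qed.

Lemma chiC alpha x : chi R alpha x = chi R x alpha.
Proof. by rewrite /chi mulnC. Qed.

Lemma chi_mulJ alpha beta x : chi R alpha x * (chi R beta x)^*%C =
  expi (pi *+ 2 * (alpha%:R - beta%:R) / n%:R) ^+ x.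
Proof.
rewrite !chiE !expiX conj_expi -expiD; congr expi.
by rewrite -mulNrn -mulrnDl; congr (_ *+ _); ring.
Qed.

Lemma expi_sub_neq1 (d : R) : 0 < d -> d < n%:R -> expi (pi *+ 2 * d / n%:R) != 1.
Proof.
move=> d0 dn; rewrite -subr_eq0; apply/eqP => h.
have n0 : 0 < n%:R :> R by lra.
have := sqn_expi_sub1 (pi *+ 2 * d / n%:R); rewrite h sqn0.
have -> : pi *+ 2 * d / n%:R / 2 = pi * (d / n%:R) by field; rewrite gt_eqF.
suff : 0 < sin (pi * (d / n%:R)).
  by move=> s0 /esym/eqP; rewrite mulf_eq0 pnatr_eq0/= sqrf_eq0 gt_eqF.
have d1 : 0 < d / n%:R by rewrite divr_gt0.
apply: sin_gt0_pi; rewrite mulr_gt0 ?pi_gt0//= gtr_pMr ?pi_gt0//.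
by rewrite ltr_pdivrMr// mul1r.
Qed.

(** For distinct frequencies the sum is geometric, with a ratio [z] such that z <> 1 and z^n = 1. *)
Lemma chi_ortho alpha beta :
  \sum_x chi R alpha x * (chi R beta x)^*%C = if alpha == beta then n%:R else 0.
Proof.
under eq_bigr do rewrite chi_mulJ.
have [->|neq] := eqVneq.
  rewrite subrr mulr0 mul0r expi0; under eq_bigr do rewrite expr1n.
  by rewrite sumr_const card_ord.
have n0 : (0 < n)%N by case: alpha {neq} => i /=; apply: leq_ltn_trans.
have n0R : n%:R != 0 :> R by rewrite pnatr_eq0 -lt0n.
set z := expi _.
have z1 : z != 1.
  have : alpha != beta :> nat by [].
  rewrite neq_ltn => /orP[] h.
    (* [expi_sub_neq1] wants a positive difference, so for alpha < beta it is applied to the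
       conjugate of the ratio. *)
    have : expi (pi *+ 2 * (beta%:R - alpha%:R) / n%:R : R) != 1.
      by apply: expi_sub_neq1;
      rewrite ?subr_gt0 ?ltr_nat// ltrBlDr -natrD ltr_nat ltn_addr.
    apply: contra => /eqP h1; rewrite -[X in _ == X]conjc1 -h1 conj_expi.
    by apply/eqP; congr expi; ring.
  by apply: expi_sub_neq1;
      rewrite ?subr_gt0 ?ltr_nat// ltrBlDr -natrD ltr_nat ltn_addr.
apply/eqP; have /eqP := subrX1 z n; suff -> : z ^+ n = 1.
  by rewrite subrr eq_sym mulf_eq0 subr_eq0 (negPf z1).
rewrite expiX (_ : _ *+ n = pi *+ 2 *+ alpha - pi *+ 2 *+ beta); last first.
  by rewrite -[LHS]mulr_natr -[_ *+ alpha]mulr_natr -[_ *+ beta]mulr_natr; field.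
by rewrite expiD -conj_expi !expi_2pi conjc1 mulr1.
Qed.

(** Fourier inversion: [chi] is symmetric in its two arguments, so orthogonality also holds when
    summing over frequencies. *)
Lemma restr_setT f x : restr f [set: 'I_n] x = f x.
Proof.
have n0 : n%:R != 0 :> R[i].
  by rewrite pnatr_eq0 -lt0n; case: x => i /=; apply: leq_ltn_trans.
transitivity (n%:R^-1 * \sum_y f y * \sum_alpha chi R x alpha * (chi R y alpha)^*%C).
  rewrite /restr big_mkcond /=.
  under eq_bigr => alpha _ do rewrite finset.in_setT /fhat /inner -mulrA mulr_suml.
  rewrite -mulr_sumr exchange_big /=; congr (_ * _); apply: eq_bigr => y _.
  rewrite mulr_sumr; apply: eq_bigr => alpha _.
  by rewrite (chiC alpha y) (chiC alpha x); ring.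
under eq_bigr do rewrite chi_ortho.
rewrite (bigD1 x)//= eqxx big1 ?addr0; first by rewrite mulrCA mulVf ?mulr1.
by move=> y /negPf; rewrite eq_sym => ->; rewrite mulr0.
Qed.

(** Pythagoras for orthonormal characters. With [a := fhat f] it yields Parseval for the full set,
    and the energy lost by [restr] for a complement. *)
Lemma norm2sq_synthesis (a : 'I_n -> R[i]) A :
  norm2sq (fun x => \sum_(alpha in A) a alpha * chi R alpha x) =
  \sum_(alpha in A) sqn (a alpha).
Proof.
case: (posnP n) => [n0|n0].
  rewrite norm2sqE !big1 ?mulr0// => i; have := ltn_ord i; by rewrite {2}n0.
have n0C : n%:R != 0 :> R[i] by rewrite pnatr_eq0 -lt0n.
apply: (@complexI R).
have -> : forall F : 'I_n -> R[i], (norm2sq F)%:C%C = inner F F.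
  move=> F; rewrite /inner; under eq_bigr do rewrite -sqnE.
  by rewrite norm2sqE -rmorph_sum -(rmorph_nat (real_complex R)) -fmorphV -rmorphM.
rewrite /inner.
transitivity (n%:R^-1 * \sum_(alpha in A) \sum_(beta in A)
    a alpha * (a beta)^*%C * \sum_x chi R alpha x * (chi R beta x)^*%C).
  congr (_ * _); under eq_bigr do rewrite rmorph_sum mulr_suml.
  rewrite exchange_big /=; apply: eq_bigr => alpha _.
  under eq_bigr do rewrite mulr_sumr.
  rewrite exchange_big /=; apply: eq_bigr => beta _.
  by rewrite mulr_sumr; apply: eq_bigr => x _; rewrite rmorphM; ring.
rewrite rmorph_sum mulr_sumr; apply: eq_bigr => alpha al.
rewrite (bigD1 alpha)//= chi_ortho eqxx big1 ?addr0.
  by rewrite sqnE mulrCA mulVf ?mulr1.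
by move=> b /andP[_ /negPf]; rewrite chi_ortho eq_sym => ->; rewrite mulr0.
Qed.

Lemma norm2sq_parseval f : norm2sq f = \sum_alpha sqn (fhat f alpha).
Proof.
transitivity (norm2sq (restr f [set: 'I_n])).
  by rewrite !norm2sqE; under [in RHS]eq_bigr do rewrite restr_setT.
rewrite norm2sq_synthesis; apply: eq_bigl => alpha; exact: finset.in_setT.
Qed.

Lemma norm2sq_sub_restr f A :
  norm2sq (fun x => f x - restr f A x) = \sum_(alpha in ~: A) sqn (fhat f alpha).
Proof.
rewrite -norm2sq_synthesis !norm2sqE; congr (_ * _); apply: eq_bigr => x _.
congr sqn; rewrite -[f x]restr_setT /restr.
rewrite (big_setID A) /= finset.setTI finset.setTD addrC addrK; apply: eq_bigr => //.
Qed.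

Lemma sqn_fhat_le f alpha : sqn (fhat f alpha) <= norm2sq f.
Proof.
rewrite norm2sq_parseval (bigD1 alpha)//= lerDl sumr_ge0// => i _.
exact: sqn_ge0.
Qed.

Lemma fhatD f g alpha : fhat (fun x => f x + g x) alpha = fhat f alpha + fhat g alpha.
Proof.
rewrite /fhat /inner -mulrDr -big_split /=; congr (_ * _).
by apply: eq_bigr => x _; rewrite mulrDl.
Qed.

Lemma fhat_sum (I : finType) (B : {pred I}) (a : I -> R[i])
    (F : I -> 'I_n -> R[i]) alpha :
  fhat (fun x => \sum_(i in B) a i * F i x) alpha =
  \sum_(i in B) a i * fhat (F i) alpha.
Proof.
rewrite /fhat /inner; under eq_bigr do rewrite mulr_suml.
rewrite exchange_big mulr_sumr; apply: eq_bigr => i _ /=.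
rewrite mulrCA !mulr_sumr; apply: eq_bigr => x _; by rewrite !mulrA.
Qed.

End Fourier.

(** * Sums and counts over unit-spaced real points *)

Section UnitSpaced.
Variable R : realType.
Implicit Types s L : R.

Lemma sum_invsqr_ge s L m : 1 <= L ->
  \sum_(b < m | L <= s + b%:R) (s + b%:R) ^- 2 <= 2 / L.
Proof.
move=> L1; have L0 : 0 < L by lra.
(* The bound telescopes: 1/z^2 <= 2/z - 2/(z+1) for z >= 1. *)
suff : \sum_(b < m | L <= s + b%:R) (s + b%:R) ^- 2 <=
       2 / L - 2 / Num.max L (s + m%:R).
  move/le_trans; apply; rewrite gerBl divr_ge0// le_max (ltW L0)//.
elim: m => [|m ih].
  rewrite big_ord0 subr_ge0 ler_pM2l// lef_pV2 ?posrE ?lt_max ?L0//.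
  by rewrite le_max lexx.
rewrite big_mkcond big_ord_recr /= -big_mkcond /= -(natr1 m) addrA.
move: ih; set z := s + m%:R; set S := \sum_(_ | _) _ => ih.
case: (leP L z) => Lz; last first.
  rewrite addr0 (le_trans ih)// lerD2l lerN2 ler_pM2l//.
  rewrite lef_pV2 ?posrE ?lt_max ?L0// (max_l (ltW Lz)) le_max lexx//.
have z0 : 0 < z by lra.
move: ih; rewrite (max_r Lz) (max_r (_ : L <= z + 1)); last by lra.
move=> ih; apply: le_trans (lerD ih (lexx _)) _.
rewrite -subr_ge0.
have -> : 2 / L - 2 / (z + 1) - (2 / L - 2 / z + z ^- 2) =
   (z - 1) * (z ^- 2 * (z + 1)^-1).
  by field; rewrite gt_eqF//= ?gt_eqF//= ?L0 //; lra.
by rewrite !mulr_ge0 ?invr_ge0 ?exprn_ge0//; lra.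
Qed.

Lemma card_itv_le s L m : 0 <= L ->
  \sum_(b < m | 0 <= s + b%:R < L) 1 <= L + 1.
Proof.
move=> L0.
(* The extra bound [Num.max 0 (s + m%:R)] closes the induction: when the new point z lies in [0, L),
   the count so far is at most z, and z + 1 < L + 1. *)
suff : \sum_(b < m | 0 <= s + b%:R < L) 1 <= Num.min (Num.max 0 (s + m%:R)) (L + 1).
  by move/le_trans; apply; rewrite ge_min lexx orbT.
elim: m => [|m ih]; first by rewrite big_ord0 le_min le_max lexx /=; lra.
rewrite big_mkcond big_ord_recr /= -big_mkcond /= -(natr1 m) addrA.
move: ih; set z := s + m%:R; set S := \sum_(_ | _) _.
rewrite !le_min !le_max => /andP[ih1 ih2].
case: ifP => [/andP[z0 zL]|_]; last first.
  rewrite addr0 ih2 andbT; case/orP: ih1 => h; apply/orP; [by left|right; lra].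
have Sz : S <= z by case/orP: ih1; lra.
by apply/andP; split; [apply/orP; right|]; lra.
Qed.

(** The reversal b -> m - 1 - b turns a decreasing progression into an increasing one, whence the
    offset 1. *)
Lemma big_rev_natB m (F : R -> R) (P : pred R) s :
  \sum_(b < m | P (s - b%:R)) F (s - b%:R) =
  \sum_(b < m | P ((s - m%:R + 1) + b%:R)) F ((s - m%:R + 1) + b%:R).
Proof.
rewrite (reindex_inj rev_ord_inj) /=.
have h (b : 'I_m) : s - (m - b.+1)%:R = s - m%:R + 1 + b%:R.
  by rewrite natrB// -natr1; ring.
by apply: eq_big => [b|b _]; rewrite h.
Qed.

End UnitSpaced.

(** * Passing from polynomials in log n to polynomials in log m *)

Section Majorant.
Variable R : realType.

(* The shift by 1 absorbs ln n <= ln m + 1, see ln_nat_le. *)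
Definition majorant (P : {poly R}) : {poly R} :=
  map_poly (fun c => `|c|) P \Po ('X + 1).

Lemma majorantE (P : {poly R}) v :
  (majorant P).[v] = \sum_(i < size P) `|P`_i| * (v + 1) ^+ i.
Proof.
rewrite /majorant horner_comp !hornerE /map_poly horner_poly.
by apply: eq_bigr.
Qed.

Lemma majorant_ge0 (P : {poly R}) v : 0 <= v -> 0 <= (majorant P).[v].
Proof.
move=> v0; rewrite majorantE sumr_ge0// => i _.
by rewrite mulr_ge0// exprn_ge0// addr_ge0.
Qed.

(** [P] need not be monotone, but with coefficients replaced by their absolute values it is
    nondecreasing on nonnegative reals, so [u] may be raised to [v + 1]. *)
Lemma le_majorant (P : {poly R}) u v : 0 <= u -> u <= v + 1 ->
  P.[u] <= (majorant P).[v].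
Proof.
move=> u0 uv; rewrite majorantE horner_coef; apply: ler_sum => i _.
apply: le_trans (ler_norm _) _; rewrite normrM normrX (ger0_norm u0).
by rewrite ler_wpM2l// lerXn2r// ?nnegrE// (le_trans u0).
Qed.

Lemma ln_nat_le (n m : nat) : (0 < n)%N -> (0 < m)%N -> n%:R / 2 <= m%:R :> R ->
  ln (n%:R : R) <= ln (m%:R : R) + 1.
Proof.
move=> n0 m0 nm.
have m0' : 0 < m%:R :> R by rewrite ltr0n.
apply: (@le_trans _ _ (ln (m%:R * 2))).
  by rewrite ler_ln ?posrE ?mulr_gt0 ?ltr0n//; lra.
rewrite lnM ?posrE// lerD2l.
by have := @le_ln1Dx R 1; apply; lra.
Qed.

End Majorant.

(** * Truncation from Z_n to Z_m and its effect on characters *)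

Section Truncation.
Variables (R : realType) (n m : nat).
Hypotheses (n_gt0 : (0 < n)%N) (m_gt0 : (0 < m)%N).
Implicit Types (f g : 'I_n -> R[i]) (alpha : 'I_n) (beta x : 'I_m).
Local Arguments conjc : simpl never.

Lemma ftildeD f g x :
  ftilde (fun y => f y + g y) x = ftilde f x + ftilde g x.
Proof. by rewrite /ftilde; case: insub => //; rewrite addr0. Qed.

Lemma ftilde_sum (I : finType) (A : {pred I}) (a : I -> R[i])
    (F : I -> 'I_n -> R[i]) x :
  ftilde (fun y => \sum_(i in A) a i * F i y) x =
  \sum_(i in A) a i * ftilde (F i) x.
Proof.
rewrite /ftilde; case: insub => // [].
by rewrite big1// => i _; rewrite mulr0.
Qed.

(** Both sums live on the indices below both n and m; [G 0 = 0] disposes of the zero padding. *)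
Lemma ftilde_sumE (V : nmodType) (G : R[i] -> V) f : G 0 = 0 ->
  \sum_(x < m) G (ftilde f x) = \sum_(y < n) if (y < m)%N then G (f y) else 0.
Proof.
move=> G0.
transitivity (\sum_(x < m) \sum_(y < n) if x == y :> nat then G (f y) else 0).
  apply: eq_bigr => x _; rewrite /ftilde; case: insubP => [y _ /= xy|nx].
    rewrite (bigD1 y)//= -xy eqxx big1 ?addr0// => y' ny.
    by rewrite ifN// eq_sym.
  rewrite G0 big1// => y _; case: eqP => // xy.
  by move: nx; rewrite /= xy ltn_ord.
rewrite exchange_big; apply: eq_bigr => y _ /=; case: ifPn => [ym|ym].
  rewrite (bigD1 (Ordinal ym))//= eqxx big1 ?addr0// => x nx.
  by rewrite ifN.
rewrite big1// => x _; case: eqP => // xy.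
by move: ym; rewrite -xy ltn_ord.
Qed.

Lemma norm2sq_ftilde_le f :
  norm2sq (@ftilde R n m f) <= n%:R / m%:R * norm2sq f.
Proof.
rewrite !norm2sqE; set S := \sum_(y < n) _.
have -> : n%:R / m%:R * (n%:R^-1 * S) = m%:R^-1 * S.
  by field; rewrite !pnatr_eq0 -!lt0n n_gt0 m_gt0.
rewrite ler_wpM2l ?invr_ge0// (ftilde_sumE (G := @sqn R)) ?sqn0//.
by apply: ler_sum => y _; case: ifP => // _; apply: sqn_ge0.
Qed.

(** The truncated character lives on the first [minn m n] points, which leaves a geometric sum; the
    product form avoids dividing by [z - 1], which may vanish. *)
Lemma fhat_ftilde_chi alpha beta :
  let z := expi (pi *+ 2 * (alpha%:R * m%:R / n%:R - beta%:R) / m%:R) : R[i] in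
  (z - 1) * (m%:R * fhat (@ftilde R n m (chi R alpha)) beta) = z ^+ minn m n - 1.
Proof.
move=> z; rewrite /fhat /inner mulVKf ?pnatr_eq0 -?lt0n// subrX1; congr (_ * _).
transitivity (\sum_(x < m) if (x < n)%N then z ^+ x else 0).
  apply: eq_bigr => x _; rewrite /ftilde; case: insubP => [y xn /= yx|/negPf /= ->].
    rewrite (xn : (x < n)%N) !chiE yx !expiX conj_expi -expiD; congr expi.
    rewrite -mulNrn -mulrnDl; congr (_ *+ _); field.
    by rewrite !pnatr_eq0 -!lt0n n_gt0 m_gt0.
  by rewrite mul0r.
rewrite -big_mkcond; symmetry.
rewrite (big_ord_widen_cond m xpredT (fun k => z ^+ k)) ?geq_minl//.
by apply: eq_bigl => x; rewrite leq_min ltn_ord.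
Qed.

(** In the geometric sum [z ^+ minn m n - 1] has modulus at most 2, while [m (z - 1)] has modulus 2
    m sin(pi d / m), at least [mu], the minimum of d and m - d. The sum of both inverse squares
    dominates [mu ^- 2] and avoids the minimum. *)
Lemma sqn_fhat_ftilde_chi_le alpha beta (d : R) :
  `|beta%:R - alpha%:R * m%:R / n%:R| = d -> 0 < d -> d < m%:R ->
  sqn (fhat (@ftilde R n m (chi R alpha)) beta) <=
  4 * (d ^- 2 + (m%:R - d) ^- 2).
Proof.
move=> dE d0 dm; have m0 : 0 < m%:R :> R by lra.
have := fhat_ftilde_chi alpha beta; move: (fhat _ _) => u /= h.
have md0 : 0 < m%:R - d by lra.
set mu := Num.min d (m%:R - d).
have mu0 : 0 < mu by rewrite lt_min d0.
have key : mu ^+ 2 * sqn u <= 4.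
  have {h} := congr1 (@sqn R) h; rewrite !sqnM expiX.
  rewrite (_ : sqn m%:R = m%:R ^+ 2); last first.
    by rewrite -(rmorph_nat (real_complex R)) /sqn /=; ring.
  rewrite sqn_expi_sub1 => /eqP; rewrite eq_le => /andP[h _].
  apply: (le_trans _ (le_trans h (sqn_expi_sub1_le _))).
  rewrite mulrA ler_wpM2r ?sqn_ge0//.
  set a := _ / 2.
  have -> : sin a ^+ 2 = sin (pi * d / m%:R) ^+ 2.
    rewrite -dE; set e := _ - _; have -> : a = - (pi * e / m%:R).
      by rewrite /a -opprB -/e; field; rewrite gt_eqF.
    by rewrite sinN sqrrN; case: (ler0P e) => // _; rewrite mulrN mulNr sinN sqrrN.
  have := sin_ge_min m0 (ltW d0) (ltW dm); rewrite -/mu; set w := sin _ => hw.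
  have h0 : 0 <= mu / (2 * m%:R) by rewrite divr_ge0// ?mulr_ge0// ltW.
  have : (mu / (2 * m%:R)) ^+ 2 <= w ^+ 2 by rewrite lerXn2r// nnegrE (le_trans h0).
  rewrite expr_div_n ler_pdivrMr ?exprn_gt0 ?mulr_gt0//.
  by have -> : 4 * w ^+ 2 * m%:R ^+ 2 = w ^+ 2 * (2 * m%:R) ^+ 2 by ring.
apply: (@le_trans _ _ (4 * mu ^- 2)).
  by rewrite ler_pdivlMr ?exprn_gt0// mulrC.
rewrite ler_wpM2l// /mu; case: (leP d) => _.
  by rewrite lerDl invr_ge0 exprn_ge0// ltW.
by rewrite lerDr invr_ge0 exprn_ge0// ltW.
Qed.

(* The four gaps measure, on either side, the cyclic distance in R/mZ from
   beta to the (real) frequency alpha m / n of the truncated character. *)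
Definition gap (i : 'I_4) alpha beta : R :=
  let d := beta%:R - alpha%:R * m%:R / n%:R in
  nth 0 [:: d; - d; m%:R - d; m%:R + d] i.

Definition near_freq L alpha beta := [exists i, 0 <= gap i alpha beta < L].

(** As [beta] varies each gap runs through unit-spaced points, so the bounds for such points apply,
    after a reversal in the decreasing case. *)
Lemma gap_affine i alpha : exists s : R,
  (forall beta, gap i alpha beta = s + beta%:R) \/
  (forall beta, gap i alpha beta = s - beta%:R).
Proof.
rewrite /gap; set y := _ / _; case: i => [[|[|[|[|//]]]] /= _].
- by exists (- y); left => b; ring.
- by exists y; right => b; ring.
- by exists (m%:R + y); right => b; ring.
- by exists (m%:R - y); left => b; ring.
Qed.

Lemma sum_gap_invsqr_le (L : R) i alpha : 1 <= L ->
  \sum_(beta | L <= gap i alpha beta) gap i alpha beta ^- 2 <= 2 / L.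
Proof.
move=> L1; have [s [h|h]] := gap_affine i alpha.
  under eq_bigl do rewrite h; under eq_bigr do rewrite h.
  exact: sum_invsqr_ge.
under eq_bigl do rewrite h; under eq_bigr do rewrite h.
by rewrite (big_rev_natB _ (fun z => z ^- 2) (fun z => L <= z)); apply: sum_invsqr_ge.
Qed.

Lemma card_gap_le (L : R) i alpha : 0 <= L ->
  \sum_(beta | 0 <= gap i alpha beta < L) 1 <= L + 1.
Proof.
move=> L1; have [s [h|h]] := gap_affine i alpha; under eq_bigl do rewrite h.
  exact: card_itv_le.
by rewrite (big_rev_natB _ (fun=> 1) (fun z => 0 <= z < L)); apply: card_itv_le.
Qed.

Lemma card_near_freq_le (L : R) alpha : 0 <= L ->
  \sum_(beta | near_freq L alpha beta) 1 <= 4 * (L + 1).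
Proof.
move=> L0.
apply: (@le_trans _ _ (\sum_(i < 4) \sum_(beta | 0 <= gap i alpha beta < L) 1)).
  under [leRHS]eq_bigr do rewrite big_mkcond.
  rewrite exchange_big big_mkcond; apply: ler_sum => beta _ /=.
  have pos (i : 'I_4) : 0 <= (if 0 <= gap i alpha beta < L then 1 else 0) :> R by case: ifP.
  case: ifP => [/existsP[i hi]|_]; last by rewrite sumr_ge0.
  by rewrite (bigD1 i)//= hi lerDl sumr_ge0.
apply: le_trans (ler_sum _ (fun i _ => card_gap_le i alpha L0)) _.
by rewrite sumr_const card_ord mulr_natl.
Qed.

(** The sign of [beta - alpha m / n] selects two nonnegative gaps with sum m. For a far [beta] both
    are at least [L], so their inverse squares control the coefficient. The constant is 4 gaps times
    4 times 2. *)
Lemma sum_far_freq_le (L : R) alpha : 1 <= L ->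
  \sum_(beta | ~~ near_freq L alpha beta)
    sqn (fhat (@ftilde R n m (chi R alpha)) beta) <= 32 / L.
Proof.
move=> L1.
pose G (i : 'I_4) beta :=
  if L <= gap i alpha beta then gap i alpha beta ^- 2 else 0.
have G0 i beta : 0 <= G i beta.
  by rewrite /G; case: ifP => // h; rewrite invr_ge0 exprn_ge0//; lra.
apply: (@le_trans _ _ (\sum_(i < 4) \sum_beta 4 * G i beta)); last first.
  apply: (@le_trans _ _ (\sum_(i < 4) 4 * (2 / L))); last first.
    by rewrite sumr_const card_ord -mulr_natl; lra.
  apply: ler_sum => i _; rewrite -mulr_sumr ler_wpM2l// -big_mkcond.
  exact: sum_gap_invsqr_le.
rewrite exchange_big big_mkcond; apply: ler_sum => beta _ /=.
rewrite -mulr_sumr; case: ifP => [|_]; last by rewrite mulr_ge0// sumr_ge0.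
rewrite negb_exists => /forallP far.
have m0 : 0 < m%:R :> R by rewrite ltr0n.
have n0 : 0 < n%:R :> R by rewrite ltr0n.
set y : R := alpha%:R * m%:R / n%:R.
have y0 : 0 <= y by rewrite divr_ge0 ?mulr_ge0.
have ym : y < m%:R.
  by rewrite ltr_pdivrMr// mulrC ltr_pM2l// ltr_nat.
have b0 : 0 <= beta%:R :> R by [].
have bm : beta%:R < m%:R :> R by rewrite ltr_nat.
pose o (i : nat) (h : (i < 4)%N) := Ordinal h.
move: (far (@o 0 isT)) (far (@o 1 isT)) (far (@o 2 isT)) (far (@o 3 isT)).
rewrite /gap /= -/y !negb_and -!ltNge -!leNgt => f0 f1 f2 f3.
have pair (i j : 'I_4) : j != i -> G i beta + G j beta <= \sum_k G k beta.
  by move=> ij; rewrite (bigD1 i)//= (bigD1 j)//= addrA lerDl sumr_ge0.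
have [by0|by0] := leP y beta%:R.
  have h0 : L <= beta%:R - y by case/orP: f0; lra.
  have h2 : L <= m%:R - (beta%:R - y) by case/orP: f2; lra.
  apply: (le_trans (@sqn_fhat_ftilde_chi_le alpha beta (beta%:R - y) _ _ _)).
  - by rewrite ger0_norm// subr_ge0.
  - by lra.
  - by lra.
  rewrite ler_wpM2l//; apply: le_trans (pair (@o 0 isT) (@o 2 isT) isT).
  by rewrite /G /gap /= -/y h0 h2.
have h1 : L <= - (beta%:R - y) by case/orP: f1; lra.
have h3 : L <= m%:R + (beta%:R - y) by case/orP: f3; lra.
apply: (le_trans (@sqn_fhat_ftilde_chi_le alpha beta (- (beta%:R - y)) _ _ _)).
- by rewrite ltr0_norm// subr_lt0.
- by lra.
- by lra.
rewrite ler_wpM2l// opprK; apply: le_trans (pair (@o 1 isT) (@o 3 isT) isT).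
by rewrite /G /gap /= -/y h1 h3.
Qed.

(** [Delta] gathers the frequencies near some [alpha] in [Gamma]. One factor [#|Gamma|] of the error
    comes from Cauchy-Schwarz, the other from adding the far energies of all [alpha]. *)
Lemma ftilde_approx f (Gamma : {set 'I_n}) (L c : R) : 1 <= L -> 0 < c ->
  exists Delta : {set 'I_m},
    #|Delta|%:R <= #|Gamma|%:R * (4 * (L + 1)) /\
    norm2sq (fun x => @ftilde R n m f x - restr (@ftilde R n m f) Delta x) <=
      (1 + c) * (n%:R / m%:R * norm2sq (fun y => f y - restr f Gamma y)) +
      (1 + c^-1) * (#|Gamma|%:R ^+ 2 * norm2sq f * (32 / L)).
Proof.
move=> L1 c0; have L0 : 0 <= L by lra.
have c1 : 0 <= 1 + c by lra.
have c2 : 0 <= 1 + c^-1 by rewrite addr_ge0 ?invr_ge0 ?ltW.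
exists [set beta | [exists alpha in Gamma, near_freq L alpha beta]].
set Delta := finset _.
split.
  rewrite -[#|Delta|%:R](sumr_const (mem Delta) (1 : R)).
  apply: (@le_trans _ _
      (\sum_(alpha in Gamma) \sum_(beta | near_freq L alpha beta) 1)).
    under [leRHS]eq_bigr do rewrite big_mkcond.
    rewrite exchange_big big_mkcond; apply: ler_sum => beta _ /=.
    have pos alpha : 0 <= (if near_freq L alpha beta then 1 else 0) :> R by case: ifP.
    case: ifP => [|_]; last by rewrite sumr_ge0.
    rewrite inE => /existsP[alpha /andP[aG near]].
    by rewrite (bigD1 alpha)//= near lerDl sumr_ge0.
  apply: le_trans (ler_sum _ (fun alpha _ => card_near_freq_le alpha L0)) _.
  by rewrite sumr_const -[leLHS]mulr_natl.
pose h y := f y - restr f Gamma y.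
have fE beta : fhat (ftilde f) beta = fhat (ftilde h) beta +
    \sum_(alpha in Gamma) fhat f alpha * fhat (@ftilde R n m (chi R alpha)) beta.
  rewrite -fhat_sum -fhatD; congr fhat; apply/funext => x.
  by rewrite -ftilde_sum -ftildeD; congr ftilde; apply/funext => y; rewrite /h subrK.
rewrite norm2sq_sub_restr.
apply: (@le_trans _ _ (\sum_(beta in ~: Delta) ((1 + c) * sqn (fhat (ftilde h) beta) +
   (1 + c^-1) * (#|Gamma|%:R * \sum_(alpha in Gamma)
      norm2sq f * sqn (fhat (@ftilde R n m (chi R alpha)) beta))))).
  apply: ler_sum => beta _; rewrite fE; apply: le_trans (sqnD_le _ _ c0) _.
  rewrite lerD2l ler_wpM2l//.
  apply: le_trans (sqn_sum _ _) _; rewrite ler_wpM2l//.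
  apply: ler_sum => alpha _; rewrite sqnM ler_wpM2r ?sqn_ge0//.
  exact: sqn_fhat_le.
rewrite big_split -!mulr_sumr /=; apply: lerD.
  rewrite ler_wpM2l//; apply: le_trans (norm2sq_ftilde_le _).
  rewrite norm2sq_parseval [leRHS](bigID (mem (~: Delta)))/= lerDl.
  by rewrite sumr_ge0// => i _; apply: sqn_ge0.
rewrite ler_wpM2l// expr2 -!mulrA ler_wpM2l//.
rewrite exchange_big /= mulr_natl -sumr_const; apply: ler_sum => alpha aG.
rewrite -mulr_sumr ler_wpM2l ?norm2sq_ge0//.
apply: le_trans (sum_far_freq_le alpha L1).
rewrite big_mkcond [leRHS]big_mkcond; apply: ler_sum => beta _ /=.
have := sqn_ge0 (fhat (@ftilde R n m (chi R alpha)) beta).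
case: ifP => [bD|_]; last by case: ifP.
(* A frequency outside [Delta] is far from every [alpha] in [Gamma]. *)
rewrite ifT//; move: bD; rewrite !inE; apply: contra => near.
by apply/existsP; exists alpha; rewrite aG.
Qed.

End Truncation.

(** * Concentration of the truncated family *)

Local Open Scope classical_set_scope.

Theorem theorem1p6 (R : realType) (n m : nat -> nat)
  (hn : forall k, (0 < n k)%N) (hm : forall k, (0 < m k)%N)
  (hnm : forall k, (n k)%:R / 2 <= (m k)%:R :> R)
  (Q : {poly R}) (f : forall k, 'I_(n k) -> R[i])
  (hf : forall k, norm2sq (f k) <= Q.[ln (n k)%:R])
  (eps : R) (heps : 0 < eps) :
  @concentrated R eps n f ->
  forall eta : R, 0 < eta ->
    @concentrated R (sup [set (n k)%:R / (m k)%:R | k in [set: nat]] * eps + eta)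
      m (fun k => @ftilde R (n k) (m k) (f k)).
Proof.
move=> [P hP] eta eta0; set t := sup _.
have m0 k : 0 < (m k)%:R :> R by rewrite ltr0n.
have t_ub k : (n k)%:R / (m k)%:R <= t.
  apply: ub_le_sup; last by exists k.
  (* The ratios are at most 2, so [sup] is taken over a bounded set and is a true upper bound. *)
  exists 2 => _ [j _ <-]; rewrite ler_pdivrMr//; have := hnm j; lra.
have t0 : 0 < t by apply: lt_le_trans (t_ub 0); rewrite divr_gt0 ?ltr0n.
(* With this [c] the first error is at most t eps + eta / 4. *)
pose c := eta / (4 * (t * eps)).
have te0 : 0 < t * eps by rewrite mulr_gt0.
have c0 : 0 < c by rewrite divr_gt0// mulr_gt0.
have d0 : 0 < 1 + c^-1 by rewrite addr_gt0 ?invr_gt0.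
(* Target for the second error before its factor [1 + c^-1], so that it costs eta / 2; the total
   stays strictly below t eps + eta. *)
pose s := eta / (2 * (1 + c^-1)).
have s0 : 0 < s by rewrite divr_gt0// mulr_gt0.
pose P1 := majorant P; pose Q1 := majorant Q.
(* [B] at log m serves as [L]: the summand 1 ensures L >= 1, the rest brings the second error below
   [s]. *)
pose B := 1 + (32 / s)%:P * (P1 ^+ 2 * Q1).
(* At most [P1] frequencies in [Gamma], each with at most 4 (L + 1) near ones. *)
exists (P1 * (4%:P * (B + 1))) => k.
have [Gamma [cardG GP]] := hP k.
pose u : R := ln (n k)%:R; pose v : R := ln (m k)%:R.
have u0 : 0 <= u by rewrite ln_ge0// ler1n.
have v0 : 0 <= v by rewrite ln_ge0// ler1n.
have uv : u <= v + 1 by apply: ln_nat_le.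
have P10 : 0 <= P1.[v] by apply: majorant_ge0.
have Q10 : 0 <= Q1.[v] by apply: majorant_ge0.
have GP1 : #|Gamma|%:R <= P1.[v] := le_trans cardG (le_majorant P u0 uv).
have fQ1 : norm2sq (f k) <= Q1.[v] := le_trans (hf k) (le_majorant Q u0 uv).
have BE : B.[v] = 1 + 32 / s * (P1.[v] ^+ 2 * Q1.[v]).
  by rewrite /B hornerD hornerM hornerM horner_exp !hornerC.
clearbody B.
have L1 : 1 <= B.[v].
  by rewrite BE lerDl !mulr_ge0 ?exprn_ge0 ?invr_ge0 ?(ltW s0).
have [Delta [cardD normD]] := ftilde_approx (hn k) (hm k) (f k) Gamma L1 c0.
exists Delta; split.
  apply: (le_trans cardD).
  rewrite !hornerM hornerC hornerD hornerC -/v ler_wpM2r//; lra.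
apply: (le_lt_trans normD).
set a := norm2sq _ in GP *.
have a1 : (n k)%:R / (m k)%:R * a <= t * eps.
  by apply: ler_pM; [rewrite divr_ge0|exact: norm2sq_ge0|exact: t_ub|exact: ltW].
have b1 : #|Gamma|%:R ^+ 2 * norm2sq (f k) * (32 / B.[v]) <= s.
  rewrite mulrA ler_pdivrMr; last by lra.
  apply: (@le_trans _ _ (P1.[v] ^+ 2 * Q1.[v] * 32)).
    rewrite ler_wpM2r// ler_pM ?exprn_ge0 ?norm2sq_ge0//.
    by rewrite lerXn2r ?nnegrE.
  have -> : s * B.[v] = s + P1.[v] ^+ 2 * Q1.[v] * 32.
    by rewrite BE; field; rewrite gt_eqF.
  by rewrite lerDr ltW.
have sE : (1 + c^-1) * s = eta / 2.
  by rewrite /s; field; rewrite !gt_eqF//; lra.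
have cE : (1 + c) * (t * eps) = t * eps + eta / 4.
  by rewrite /c; field; rewrite !gt_eqF.
have a2 : (1 + c) * ((n k)%:R / (m k)%:R * a) <= (1 + c) * (t * eps).
  by rewrite ler_wpM2l//; lra.
have b2 := ler_wpM2l (ltW d0) b1.
lra.
Qed.
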